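(* The categories $\mathbf{SubS4}_h$ and $\mathbf{SubS4}_{st}$ are dually equivalent to the categories $\mathbf{BiSpS4}_s$ and $\mathbf{BiSpS4}_{st}$, respectively.
   Context: A subordination on a Boolean algebra $A$ is a binary relation $\prec$ on $A$ such that: (S1) $0\prec 0$ and $1\prec 1$; (S2) $a\prec b$ and $a\prec c$ imply $a\prec b\wedge c$; (S3) $a\prec c$ and $b\prec c$ imply $a\vee b\prec c$; (S4) $a\leq b\prec c\leq d$ implies $a\prec d$. The pair $\langle A,\prec\rangle$ is an S4-subordination algebra if moreover (S5) $a\prec b$ implies $a\leq b$, and (S6) $a\prec b$ implies that there is $c\in A$ with $a\prec c\prec b$. A subordination homomorphism $h:\langle A_1,\prec_1\rangle\to\langle A_2,\prec_2\rangle$ is a Boolean homomorphism such that $a\prec_1 b$ implies $h(a)\prec_2 h(b)$. It is a strong subordination homomorphism if moreover (QH): if $a\prec_2 h(b)$ (with $a\in A_2$, $b\in A_1$), then there exists $c\in A_1$ such that $a\leq h(c)$ and $c\prec_1 b$. $\mathbf{SubS4}_h$ (resp. $\mathbf{SubS4}_{st}$) is the category of S4-subordination algebras with subordination homomorphisms (resp. strong subordination homomorphisms). Let $\langle X,\tau,\tau_S\rangle$ be a bitopological space (a set with two topologies). $\mathrm{Clop}(X)$ denotes the Boolean algebra of clopen subsets of $\langle X,\tau\rangle$; $\mathrm{int}_S$ denotes interior with respect to $\tau_S$. For $x,y\in X$: $x\leq_S y$ iff for all $U\in\mathrm{Clop}(X)$, $x\in\mathrm{int}_S(U)$ implies $y\in\mathrm{int}_S(U)$;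 $x\triangleleft_S y$ iff for all $U\in\mathrm{Clop}(X)$, $x\in\mathrm{int}_S(U)$ implies $y\in U$. The space is an S4-subordination space if: (Sp1) $\langle X,\tau\rangle$ is a Stone space; (Sp2) $\{\mathrm{int}_S(U):U\in\mathrm{Clop}(X)\}$ is a base for $\tau_S$; (Sp3) $\mathrm{int}_S(U)\in\tau$ for each $U\in\mathrm{Clop}(X)$; (Sp4) $\triangleleft_S\subseteq\leq_S$. Let $\langle X_i,\tau_i,\tau_{S_i}\rangle$, $i=1,2$, be S4-subordination spaces. A function $f:X_1\to X_2$ continuous from $\langle X_1,\tau_1\rangle$ to $\langle X_2,\tau_2\rangle$ is stable if $x\triangleleft_{S_1}y$ implies $f(x)\triangleleft_{S_2}f(y)$ for all $x,y\in X_1$. It is strong stable if it is stable and whenever $f(x)\triangleleft_{S_2}y$ (with $x\in X_1$, $y\in X_2$) there exists $z\in X_1$ such that $x\triangleleft_{S_1}z$ and $f(z)=y$. $\mathbf{BiSpS4}_s$ (resp. $\mathbf{BiSpS4}_{st}$) is the category of S4-subordination spaces with stable (resp. strong stable) functions as morphisms. Composition in all four categories is the usual composition of functions. *)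

(* Defs.v *)
From HB Require Import structures.
From mathcomp Require Import all_boot all_order.
From mathcomp Require Import all_classical.
From mathcomp Require Import topology_structure compact separation_axioms.

Set Implicit Arguments.
Unset Strict Implicit.
Unset Printing Implicit Defensive.

Import Order.LTheory.

Local Open Scope classical_set_scope.

(** * Categories *)

Record category := Category {
  obj :> Type;
  hom : obj -> obj -> Type;
  idm : forall a, hom a a;
  (* [compm g f] is "g after f" *)
  compm : forall a b c, hom b c -> hom a b -> hom a c;
  compmA : forall a b c d (h : hom c d) (g : hom b c) (f : hom a b),
    compm h (compm g f) = compm (compm h g) f;
  comp1m : forall a b (f : hom a b), compm (idm b) f = f;
  compm1 : forall a b (f : hom a b), compm f (idm a) = f
}.
Arguments hom {_} a b.
Arguments idm {_} a.
Arguments compm {_ a b c} g f : rename.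

Definition op_category (C : category) : category :=
  @Category C (fun a b => @hom C b a) (fun a => idm a)
    (fun a b c g f => compm f g)
    (fun a b c d h g f => esym (compmA f g h))
    (fun a b f => compm1 f) (fun a b f => comp1m f).

Record functor (C D : category) := Functor {
  fobj :> C -> D;
  fmap : forall a b : C, hom a b -> hom (fobj a) (fobj b);
  fmap1 : forall a : C, fmap (idm a) = idm (fobj a);
  fmapM : forall (a b c : C) (g : hom b c) (f : hom a b),
    fmap (compm g f) = compm (fmap g) (fmap f)
}.
Arguments fmap {C D} F {a b} f : rename.

Definition id_functor (C : category) : functor C C :=
  @Functor C C id (fun a b f => f) (fun=> erefl) (fun a b c g f => erefl).

Lemma comp_fmap1 (C D E : category) (G : functor D E) (F : functor C D)
  (a : C) : fmap G (fmap F (idm a)) = idm (G (F a)).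
Proof. by rewrite !fmap1. Qed.

Lemma comp_fmapM (C D E : category) (G : functor D E) (F : functor C D)
  (a b c : C) (g : hom b c) (f : hom a b) :
  fmap G (fmap F (compm g f)) =
  compm (fmap G (fmap F g)) (fmap G (fmap F f)).
Proof. by rewrite !fmapM. Qed.

Definition comp_functor (C D E : category) (G : functor D E)
    (F : functor C D) : functor C E :=
  @Functor C E (fun a => G (F a)) (fun a b f => fmap G (fmap F f))
    (comp_fmap1 G F) (comp_fmapM G F).

Definition is_iso (C : category) (a b : C) (f : hom a b) : Prop :=
  exists g : hom b a, compm g f = idm a /\ compm f g = idm b.

Definition naturally_isomorphic (C D : category) (F G : functor C D) : Prop :=
  exists eta : forall a : C, hom (F a) (G a),
    (forall a, is_iso (eta a)) /\
    (forall (a b : C) (f : hom a b),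
      compm (eta b) (fmap F f) = compm (fmap G f) (eta a)).

Definition equivalent (C D : category) : Prop :=
  exists (F : functor C D) (G : functor D C),
    naturally_isomorphic (id_functor C) (comp_functor G F) /\
    naturally_isomorphic (comp_functor F G) (id_functor D).

Definition dually_equivalent (C D : category) : Prop :=
  equivalent (op_category C) D.

(* Categories whose morphisms are the functions satisfying [P], with the usual
   composition of functions. *)
Section ConcreteCategory.
Variables (T : Type) (carrier : T -> Type).
Variable P : forall a b : T, (carrier a -> carrier b) -> Prop.
Hypothesis P_id : forall a, P (a := a) (b := a) (fun x => x).
Hypothesis P_comp : forall a b c (g : carrier b -> carrier c)
  (f : carrier a -> carrier b), P g -> P f -> P (fun x => g (f x)).

Let chom (a b : T) := {f : carrier a -> carrier b | P f}.

Let cid a : chom a a := exist _ (fun x => x) (P_id a).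

Let ccomp a b c (g : chom b c) (f : chom a b) : chom a c :=
  exist _ (fun x => sval g (sval f x)) (P_comp (svalP g) (svalP f)).

Let ccompA a b c d (h : chom c d) (g : chom b c) (f : chom a b) :
  ccomp h (ccomp g f) = ccomp (ccomp h g) f.
Proof. exact: eq_exist. Qed.

Let ccomp1m a b (f : chom a b) : ccomp (cid b) f = f.
Proof. by case: f => f Pf; exact: eq_exist. Qed.

Let ccompm1 a b (f : chom a b) : ccomp f (cid a) = f.
Proof. by case: f => f Pf; exact: eq_exist. Qed.

Definition concrete_category : category :=
  Category ccompA ccomp1m ccompm1.
End ConcreteCategory.

(** * S4-subordination algebras *)

Record is_subordination d (A : ctbDistrLatticeType d) (prec : A -> A -> Prop)
    : Prop := IsSubordination {
  sub_bot : prec \bot%O \bot%O;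
  sub_top : prec \top%O \top%O;
  sub_meet : forall a b c, prec a b -> prec a c -> prec a (b `&` c)%O;
  sub_join : forall a b c, prec a c -> prec b c -> prec (a `|` b)%O c;
  sub_mono : forall a b c d,
    (a <= b)%O -> prec b c -> (c <= d)%O -> prec a d
}.

Record is_S4_subordination d (A : ctbDistrLatticeType d)
    (prec : A -> A -> Prop) : Prop := IsS4Subordination {
  S4_sub : is_subordination prec;
  S4_le : forall a b, prec a b -> (a <= b)%O;
  S4_interp : forall a b, prec a b -> exists c, prec a c /\ prec c b
}.

(* The trivial algebra ([\bot = \top]) is allowed; it is dual to the empty space. *)
Record S4_algebra := S4Algebra {
  alg_disp : Order.disp_t;
  alg :> ctbDistrLatticeType alg_disp;
  prec : alg -> alg -> Prop;
  precP : is_S4_subordination prec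
}.
Arguments prec {s} a b.

Record is_boolean_hom d1 d2 (A : ctbDistrLatticeType d1)
    (B : ctbDistrLatticeType d2) (h : A -> B) : Prop := IsBooleanHom {
  hom_meet : Order.meet_morphism h;
  hom_join : Order.join_morphism h;
  hom_compl : {morph h : a / (~` a)%O};
  hom_bot : h \bot%O = \bot%O;
  hom_top : h \top%O = \top%O
}.

Record is_sub_hom (A B : S4_algebra) (h : A -> B) : Prop := IsSubHom {
  sub_hom_bool : is_boolean_hom h;
  sub_hom_prec : forall a b : A, prec a b -> prec (h a) (h b)
}.

Record is_strong_sub_hom (A B : S4_algebra) (h : A -> B) : Prop :=
    IsStrongSubHom {
  strong_sub_hom : is_sub_hom h;
  strong_sub_homQ : forall (a : B) (b : A), prec a (h b) ->
    exists c : A, (a <= h c)%O /\ prec c b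
}.

Lemma is_sub_hom_id (A : S4_algebra) : is_sub_hom (A := A) (B := A) (fun x => x).
Proof. by []. Qed.

Lemma is_sub_hom_comp (A B C : S4_algebra) (g : B -> C) (f : A -> B) :
  is_sub_hom g -> is_sub_hom f -> is_sub_hom (fun x => g (f x)).
Proof.
case=> [[gI gU gC g0 g1] gP] [[fI fU fC f0 f1] fP]; split; last first.
  by move=> a b /fP/gP.
split; [by move=> x y; rewrite fI gI|by move=> x y; rewrite fU gU| | | ].
- by move=> x; rewrite fC gC.
- by rewrite f0 g0.
- by rewrite f1 g1.
Qed.

Lemma is_strong_sub_hom_id (A : S4_algebra) :
  is_strong_sub_hom (A := A) (B := A) (fun x => x).
Proof. by split=> // a b ab; exists a. Qed.

Lemma is_strong_sub_hom_comp (A B C : S4_algebra) (g : B -> C) (f : A -> B) :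
  is_strong_sub_hom g -> is_strong_sub_hom f ->
  is_strong_sub_hom (fun x => g (f x)).
Proof.
case=> [gH gQ] [fH fQ]; split; first exact: is_sub_hom_comp.
move=> a b /gQ[c [ac /fQ[d [cd db]]]]; exists d; split=> //.
apply: le_trans ac _.
have gI := hom_meet (sub_hom_bool gH).
by apply/meet_idPl; rewrite -gI;
  congr g; apply/meet_idPl.
Qed.

Definition SubS4_h : category :=
  concrete_category is_sub_hom_id is_sub_hom_comp.

Definition SubS4_st : category :=
  concrete_category is_strong_sub_hom_id is_strong_sub_hom_comp.

(** * S4-subordination spaces *)

Record bitopological := BiTopological {
  bitop_tau :> topologicalType;
  bitop_tauS : Topological.axioms_ bitop_tau
}.

(* The same points with the second topology. [X] itself coerces to its first
   topology, so unannotated [open], [clopen], [continuous] below refer to the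
   latter. *)
Definition tauS (X : bitopological) : topologicalType :=
  Topological.Pack (bitop_tauS X).

Definition int_S (X : bitopological) (U : set X) : set X :=
  @interior (tauS X) U.

Definition spec_le (X : bitopological) (x y : X) : Prop :=
  forall U : set X, clopen U -> int_S U x -> int_S U y.

Definition spec_tri (X : bitopological) (x y : X) : Prop :=
  forall U : set X, clopen U -> int_S U x -> U y.

(* [zero_dimensional] is separation of distinct points by clopen sets. *)
Definition stone_space (T : topologicalType) : Prop :=
  [/\ compact [set: T], hausdorff_space T & zero_dimensional T].

Record is_S4_space (X : bitopological) : Prop := IsS4Space {
  Sp_stone : stone_space X;
  Sp_base : @basis (tauS X) [set int_S U | U in [set U : set X | clopen U]];
  Sp_open : forall U : set X, clopen U -> open (int_S U);
  Sp_incl : forall x y : X, spec_tri x y -> spec_le x y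
}.

Record S4_space := S4Space {
  space :> bitopological;
  spaceP : is_S4_space space
}.

Record is_stable (X Y : S4_space) (f : X -> Y) : Prop := IsStable {
  stable_continuous : continuous f;
  stable_tri : forall x y : X, spec_tri x y -> spec_tri (f x) (f y)
}.

Record is_strong_stable (X Y : S4_space) (f : X -> Y) : Prop :=
    IsStrongStable {
  strong_stable : is_stable f;
  strong_stable_back : forall (x : X) (y : Y), spec_tri (f x) y ->
    exists z : X, spec_tri x z /\ f z = y
}.

Lemma is_stable_id (X : S4_space) : is_stable (X := X) (Y := X) (fun x => x).
Proof. by split=> // x; exact: cvg_id. Qed.

Lemma is_stable_comp (X Y Z : S4_space) (g : Y -> Z) (f : X -> Y) :
  is_stable g -> is_stable f -> is_stable (fun x => g (f x)).
Proof.
case=> [gC gT] [fC fT]; split; last by move=> x y /fT/gT.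
by move=> x; apply: continuous_comp; [exact: fC|exact: gC].
Qed.

Lemma is_strong_stable_id (X : S4_space) :
  is_strong_stable (X := X) (Y := X) (fun x => x).
Proof. by split=> [|x y xy]; [exact: is_stable_id|exists y]. Qed.

Lemma is_strong_stable_comp (X Y Z : S4_space) (g : Y -> Z) (f : X -> Y) :
  is_strong_stable g -> is_strong_stable f ->
  is_strong_stable (fun x => g (f x)).
Proof.
case=> [gS gB] [fS fB]; split; first exact: is_stable_comp.
by move=> x z /gB[y [/fB[w [xw <-]] <-]]; exists w.
Qed.

Definition BiSpS4_s : category :=
  concrete_category is_stable_id is_stable_comp.

Definition BiSpS4_st : category :=
  concrete_category is_strong_stable_id is_strong_stable_comp.

(* Main.v *)
From HB Require Import structures.
From mathcomp Require Import all_boot all_order.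
From mathcomp Require Import all_classical.
From mathcomp Require Import topology_structure compact separation_axioms.
From mathcomp Require Import subspace_topology.
Require Import Defs.

(** The duality extends Stone duality.

    An algebra [A] is sent to the set of its ultrafilters.  The first topology
    has the sets [stone_set a] (ultrafilters containing [a]) as a base, and
    these are exactly its clopen sets.  The second has as a base the sets
    [stone_int a] (ultrafilters containing some [b] with [prec b a]).
    Interpolation in [A] makes [stone_int a] the interior of [stone_set a] for
    the second topology, so all the data of a subordination space can be read
    off from [prec]: [spec_tri u v] says that whatever lies above an element of
    [u] for [prec] belongs to [v].

    A space [X] is sent to its clopen sets, with [U] below [V] when [U] is
    contained in [int_S V].  Here interpolation is the delicate axiom.  Since
    [spec_tri] is contained in [spec_le], all the [spec_tri]-successors of a
    point of [int_S V] lie in [int_S V]; they form an intersection of clopen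
    sets, so compactness puts one of these clopen sets inside [int_S V]
    ([spec_tri_compact]), and compactness of [U] glues finitely many of them
    ([int_S_interpolate]).  The same argument shows that a point belongs to
    [int_S V] exactly when all its [spec_tri]-successors belong to [V]
    ([int_S_spec_tri]), which is why the inverse image under a map that is only
    assumed continuous and stable preserves the subordination.

    On morphisms both functors are inverse images.  A strong homomorphism [h]
    yields the back condition because, for an ultrafilter [v] and a successor
    [y] of its inverse image, the [prec]-successors of [v] and the [h]-images
    of members of [y] generate a proper filter; an ultrafilter extending it is
    the required point.  Conversely, if [f] is strong stable and a clopen [U]
    lies in [int_S (f @^-1` V)], the back condition gives [f @` U `<=` int_S V],
    and a clopen set can be inserted between this compact set and this open set.

    The units are [a |-> stone_set a] and [x |-> {U clopen | x in U}].  Both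
    are bijections that preserve and reflect the structure, so their inverses
    are morphisms too; and an isomorphism is automatically strong.  Hence one
    argument ([wide_duality]) covers both pairs of categories. *)

Set Implicit Arguments.
Unset Strict Implicit.
Unset Printing Implicit Defensive.

Import Order.LTheory Order.CTheory.

Local Open Scope classical_set_scope.

(** * Induction on compact sets *)

(** The sets [S] with [Q (K `\` S)] form a filter; it would be proper if [Q K]
    failed, and would then have no cluster point in [K].  This packages the
    passage to finite subcovers used everywhere below. *)
Lemma compact_ind (T : topologicalType) (K : set T) (Q : set (set T)) :
  compact K -> Q set0 ->
  (forall U V, Q U -> Q V -> Q (U `|` V)) ->
  (forall U V, U `<=` V -> Q V -> Q U) ->
  (forall x, K x -> exists2 N, nbhs x N & Q N) -> Q K.
Proof.
move=> cK Q0 QU Qsub Qloc; apply: contrapT => nQK.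
pose F : set_system T := [set S | Q (K `\` S)].
have FF : ProperFilter F.
  split; first by rewrite /F /= setD0.
  split; first by rewrite /F /= setDT.
    by move=> S S' FS FS'; rewrite /F /= setDIr; exact: QU.
  by move=> S S' SS'; apply: Qsub; exact: setDS.
have [|x [Kx clx]] := cK F FF; first by rewrite /F /= setDv.
have [N xN QN] := Qloc x Kx.
have FN : F (~` N) by apply: Qsub QN; rewrite setDE setCK; exact: subIsetr.
by have [y []] := clx _ _ FN xN.
Qed.

(** * Topologies generated by a base *)

Section BaseTopology.
Variables (T I : Type) (b : I -> set T).

Definition generated_open : set_system T :=
  [set O | forall x, O x -> exists2 i, b i x & b i `<=` O].

Lemma generated_openT : (forall x, exists i, b i x) -> generated_open setT.
Proof. by move=> bT x _; have [i bix] := bT x; exists i. Qed.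

Lemma generated_openI :
  (forall i j, exists k, b i `&` b j = b k) -> setI_closed generated_open.
Proof.
move=> bI O O' oO oO' x [/oO[i bx bO] /oO'[j bx' bO']].
have [k bk] := bI i j; exists k; rewrite -bk //.
by move=> y [/bO ? /bO'].
Qed.

Lemma generated_open_bigU (J : Type) (f : J -> set T) :
  (forall j, generated_open (f j)) -> generated_open (\bigcup_j f j).
Proof.
move=> of_ x [j _ /of_[i bx bf]]; exists i => // y /bf fy; by exists j.
Qed.

End BaseTopology.

(** * Ultrafilters of a Boolean algebra *)

Section Ultrafilters.
Context {d : Order.disp_t} {A : ctbDistrLatticeType d}.
Implicit Types (a b c : A) (F : set A).

Record is_filter F : Prop := IsFilter {
  filter_top : F \top%O;
  filter_meet : forall a b, F a -> F b -> F (a `&` b)%O;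
  filter_le : forall a b, (a <= b)%O -> F a -> F b
}.

Record is_ultrafilter F : Prop := IsUltrafilter {
  ultra_filter : is_filter F;
  ultra_compl : forall a, F (~` a)%O <-> ~ F a
}.

Lemma ultra_bot F : is_ultrafilter F -> ~ F \bot%O.
Proof.
move=> [fF /(_ \bot%O)[+ _]]; rewrite compl0; apply; exact: filter_top.
Qed.

Lemma ultra_meetE F a b : is_ultrafilter F -> F (a `&` b)%O <-> F a /\ F b.
Proof.
move=> [fF _]; split=> [Fab|[Fa Fb]]; last exact: filter_meet.
by split; apply: filter_le Fab; rewrite ?leIl ?leIr.
Qed.

Lemma ultra_joinE F a b : is_ultrafilter F -> F (a `|` b)%O <-> F a \/ F b.
Proof.
move=> uF; rewrite -[(a `|` b)%O]complK complU (ultra_compl uF).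
rewrite (ultra_meetE _ _ uF) !(ultra_compl uF).
split=> [/not_andP[]/contrapT ?|]; [by left|by right|].
by move=> [?|?] [].
Qed.

Lemma ultra_sub F G : is_ultrafilter F -> is_ultrafilter G -> F `<=` G -> F = G.
Proof.
move=> uF uG FG; apply/seteqP; split=> // a Ga; apply: contrapT.
by move=> /(ultra_compl uF)/FG/(ultra_compl uG).
Qed.

(** If [a] is not in [F], the filter generated by [F] and [a] is strictly
    larger, hence contains [\bot]: some [b] in [F] is disjoint from [a]. *)
Lemma maximal_filter_ultra F : is_filter F -> ~ F \bot%O ->
  (forall G, is_filter G -> ~ G \bot%O -> F `<=` G -> G `<=` F) ->
  is_ultrafilter F.
Proof.
move=> fF F0 Fmax; split=> // a; split=> [Fna Fa|nFa].
  by apply: F0; rewrite -(meetxC a); exact: filter_meet.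
pose G : set A := [set c | exists2 b, F b & (b `&` a <= c)%O].
have fG : is_filter G.
  split.
  - by exists \top%O; [exact: filter_top|exact: lex1].
  - move=> c c' [b Fb bc] [b' Fb' bc']; exists (b `&` b')%O.
      exact: filter_meet.
    by rewrite lexI (le_trans _ bc) ?(le_trans _ bc')// leI2 ?leIl ?leIr.
  - by move=> c c' cc' [b Fb bc]; exists b => //; exact: le_trans cc'.
have [b Fb ba] : G \bot%O.
  apply: contrapT => G0; apply: nFa; apply: (Fmax G) => //.
    by move=> b Fb; exists b => //; exact: leIl.
  by exists \top%O; [exact: filter_top|rewrite meet1x].
by apply: (filter_le fF _ Fb); rewrite -disj_leC -lex0.
Qed.

Lemma filter_extension F : is_filter F -> ~ F \bot%O ->
  exists2 u, is_ultrafilter u & F `<=` u.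
Proof.
move=> fF F0.
(* Indexing by the part added to [F] lets the empty chain be bounded too. *)
pose P : set (set A) := [set X | is_filter (F `|` X) /\ ~ (F `|` X) \bot%O].
have [|X [[fFX FX0] Xmax]] := @Zorn_bigcup A P.
  move=> C CP Ctot.
  have [->|/set0P[X0 CX0]] := eqVneq C set0.
    by rewrite bigcup_set0; split; rewrite setU0.
  have bigE a : (F `|` \bigcup_(X in C) X) a -> exists2 X, C X & (F `|` X) a.
    by case=> [Fa|[X CX Xa]]; [exists X0; [|left]|exists X; [|right]].
  have subE X : C X -> F `|` X `<=` F `|` \bigcup_(X in C) X.
    by move=> CX a [Fa|Xa]; [left|right; exists X].
  split; last by move=> /bigE[X /CP[_ nX] /nX].
  split.
  - by left; exact: filter_top.
  - move=> a b /bigE[X CX Xa] /bigE[Y CY Yb].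
    have [XY|YX] := Ctot X Y CX CY.
      apply: (subE _ CY); have [fY _] := CP _ CY; apply: filter_meet => //.
      by case: Xa => [Fa|/XY]; [left|right].
    apply: (subE _ CX); have [fX _] := CP _ CX; apply: filter_meet => //.
    by case: Yb => [Fa|/YX]; [left|right].
  - move=> a b ab /bigE[X CX Xa]; apply: (subE _ CX).
    by have [fX _] := CP _ CX; exact: filter_le ab Xa.
exists (F `|` X); last exact: subsetUl.
apply: maximal_filter_ultra => // G fG G0 FXG; apply: contrapT => nGFX.
have FG : F `<=` G by apply: subset_trans FXG; exact: subsetUl.
have XG : X `<=` G by apply: subset_trans FXG; exact: subsetUr.
apply: (Xmax G); last by split; rewrite (setUidr FG).
split=> // GX; apply: nGFX; apply: subset_trans GX _; exact: subsetUr.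
Qed.

Lemma ultra_separation a b : ~ (a <= b)%O ->
  exists2 u, is_ultrafilter u & u a /\ ~ u b.
Proof.
move=> ab; pose F : set A := [set c | (a `&` ~` b <= c)%O].
have [| |u uu Fu] := @filter_extension F.
- split; rewrite /F /=; first exact: lex1.
    by move=> x y ax ay; rewrite lexI ax.
  by move=> x y xy ax; exact: le_trans ax xy.
- rewrite /F /= lex0 => ab0; apply: ab.
  by rewrite -[b]complK -disj_leC.
exists u => //; have /(ultra_meetE _ _ uu)[? /(ultra_compl uu)//] :=
  Fu _ (lexx (a `&` ~` b)%O).
Qed.

End Ultrafilters.

(** * The Stone space of a Boolean algebra *)

Definition stone_point d (A : ctbDistrLatticeType d) : Type :=
  {u : set A | is_ultrafilter u}.

HB.instance Definition _ d (A : ctbDistrLatticeType d) :=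
  gen_eqMixin (stone_point A).
HB.instance Definition _ d (A : ctbDistrLatticeType d) :=
  gen_choiceMixin (stone_point A).

Section StoneSpace.
Context {d : Order.disp_t} {A : ctbDistrLatticeType d}.
Implicit Types (a b : A) (u v : stone_point A).

Definition stone_set a : set (stone_point A) := [set u | sval u a].

(** Ultrafilters are maximal, so one inclusion is enough. *)
Lemma stone_point_eq u v : sval u `<=` sval v -> u = v.
Proof.
by move=> uv; apply: eq_sig_hprop; [|apply: ultra_sub uv; apply: svalP].
Qed.

Lemma stone_set_top : stone_set \top%O = setT.
Proof.
by apply/seteqP; split=> // u _; exact: filter_top (ultra_filter (svalP u)).
Qed.

Lemma stone_set_bot : stone_set \bot%O = set0.
Proof. by apply/seteqP; split=> // u /(ultra_bot (svalP u)). Qed.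

Lemma stone_set_meet a b : stone_set (a `&` b)%O = stone_set a `&` stone_set b.
Proof.
by apply/funext => u; apply/propext; exact: (ultra_meetE _ _ (svalP u)).
Qed.

Lemma stone_set_join a b : stone_set (a `|` b)%O = stone_set a `|` stone_set b.
Proof.
by apply/funext => u; apply/propext; exact: (ultra_joinE _ _ (svalP u)).
Qed.

Lemma stone_set_compl a : stone_set (~` a)%O = ~` stone_set a.
Proof.
by apply/funext => u; apply/propext; exact: (ultra_compl (svalP u) a).
Qed.

Lemma stone_set_le a b : stone_set a `<=` stone_set b <-> (a <= b)%O.
Proof.
split=> [ab|ab u]; last exact: filter_le (ultra_filter (svalP u)) _ _ ab.
apply: contrapT => /ultra_separation[u uu [ua]].
by have := ab (exist _ u uu) ua.
Qed.

Lemma stone_set_inj : injective stone_set.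
Proof.
move=> a b ab; apply: le_anti; apply/andP.
by split; apply/stone_set_le; rewrite ab.
Qed.

Lemma stone_set_cover u : exists a, stone_set a u.
Proof. by exists \top%O; rewrite stone_set_top. Qed.

Lemma stone_set_baseI a b : exists c, stone_set a `&` stone_set b = stone_set c.
Proof. by exists (a `&` b)%O; rewrite stone_set_meet. Qed.

HB.instance Definition _ := isOpenTopological.Build (stone_point A)
  (generated_openT stone_set_cover) (generated_openI stone_set_baseI)
  (@generated_open_bigU _ _ stone_set).

Lemma clopen_stone_set a : clopen (stone_set a).
Proof.
have oS b : open (stone_set b) by move=> u bu; exists b.
split=> //; rewrite -[stone_set a]setCK -stone_set_compl.
exact: open_closedC.
Qed.

Lemma nbhs_stoneP u (N : set (stone_point A)) :
  nbhs u N <-> exists2 a, stone_set a u & stone_set a `<=` N.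
Proof.
rewrite nbhsE; split=> [[O [oO Ou] ON]|[a au aN]].
  by have [a au aO] := oO u Ou; exists a => //; exact: subset_trans ON.
by exists (stone_set a) => //; split=> //; exact: (clopen_stone_set a).1.
Qed.

(** An ultrafilter [F] of sets of points converges to the point
    [{a | F (stone_set a)}]. *)
Lemma compact_stone : compact [set: stone_point A].
Proof.
rewrite compact_ultra => F FU _.
have uF : is_ultrafilter [set a | F (stone_set a)].
  have FF : ProperFilter F by exact: ultra_proper.
  split; first split=> /=.
  - by rewrite stone_set_top; exact: filterT.
  - by move=> a b Fa Fb; rewrite stone_set_meet; exact: filterI.
  - by move=> a b ab; apply: filterS; exact/stone_set_le.
  - move=> a /=; rewrite stone_set_compl; split=> [FnA FA|nFA].
      apply: (@filter_not_empty _ F); rewrite -(setICr (stone_set a)).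
      exact: filterI.
    by case: (in_ultra_setVsetC (stone_set a) FU).
exists (exist _ _ uF); split=> //= N /nbhs_stoneP[a Fa aN].
exact: filterS aN Fa.
Qed.

Lemma stone_space_stone : stone_space (stone_point A).
Proof.
have zd : zero_dimensional (stone_point A).
  move=> u v uv; have [a [ua va]] : exists a, sval u a /\ ~ sval v a.
    apply: contrapT => /forallNP nuv; apply/negP: uv; rewrite negbK.
    apply/eqP/stone_point_eq => a ua; apply: contrapT => nva.
    by apply: (nuv a).
  by exists (stone_set a); split=> //; exact: clopen_stone_set.
split=> //; first exact: compact_stone.
move=> u v uv; apply: contrapT => /eqP/zd[U [[oU cU] Uu Uv]].
have [w []] : U `&` ~` U !=set0.
  by apply: uv; apply: open_nbhs_nbhs; split=> //; exact: closed_openC.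
by [].
Qed.

(** A clopen set is compact and is covered by the basic sets it contains;
    finitely many of these suffice, and basic sets are closed under unions. *)
Lemma clopen_is_stone_set (C : set (stone_point A)) :
  clopen C -> exists a, stone_set a = C.
Proof.
move=> [oC cC]; pose Q S := exists2 a, S `<=` stone_set a & stone_set a `<=` C.
suff [a Ca aC] : Q C by exists a; apply/seteqP.
apply: compact_ind => //.
- exact: subclosed_compact cC compact_stone _.
- by exists \bot%O; rewrite stone_set_bot.
- move=> U V [a Ua aC] [b Vb bC]; exists (a `|` b)%O.
    by rewrite stone_set_join; exact: setUSS.
  by rewrite stone_set_join subUset.
- by move=> U V UV [a Va aC]; exists a => //; exact: subset_trans Va.
- move=> u Cu; have [a au aC] := oC u Cu.
  exists (stone_set a); last by exists a.
  by apply/nbhs_stoneP; exists a.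
Qed.

End StoneSpace.

(** * The Boolean algebra of clopen sets *)

Section ClopenAlgebra.
Variable X : topologicalType.

Definition clopenb : pred (set X) := fun U => `[< clopen U >].

Definition clopens : Type := {U : set X | clopenb U}.

HB.instance Definition _ := SubChoice.on clopens.

Lemma clopenb0 : \bot%O \in clopenb.
Proof. by apply/asboolP; exact: clopen0. Qed.

Lemma clopenbT : \top%O \in clopenb.
Proof. by apply/asboolP; exact: clopenT. Qed.

Lemma clopenbI : Order.ClosedPredicates.meet_closed clopenb.
Proof.
by move=> U V /asboolP cU /asboolP cV; apply/asboolP; exact: clopenI.
Qed.

Lemma clopenbU : Order.ClosedPredicates.join_closed clopenb.
Proof.
by move=> U V /asboolP cU /asboolP cV; apply/asboolP; exact: clopenU.
Qed.

HB.instance Definition _ :=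
  Order.SubChoice_isTBSubLattice.Build set_display (set X) clopenb set_display
    clopens clopenbI clopenbU clopenb0 clopenbT.

Lemma clopens_meetUl : @left_distributive clopens clopens Order.meet Order.join.
Proof. by move=> U V W; apply: val_inj; exact: setIUl. Qed.

HB.instance Definition _ :=
  Order.Lattice_Meet_isDistrLattice.Build set_display clopens clopens_meetUl.

Lemma clopenbC (U : clopens) : clopenb (~` val U).
Proof.
by have /asboolP cU := valP U; apply/asboolP; exact: clopenC set0 cU.
Qed.

Definition clopens_compl (U : clopens) : clopens :=
  exist clopenb _ (clopenbC U).

Lemma clopens_joinxC (U : clopens) : (U `|` clopens_compl U)%O = \top%O.
Proof. by apply: val_inj; exact: setUCr. Qed.

Lemma clopens_meetxC (U : clopens) : (U `&` clopens_compl U)%O = \bot%O.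
Proof. by apply: val_inj; exact: setICr. Qed.

HB.instance Definition _ :=
  Order.TBDistrLattice_hasComplement.Build set_display clopens
    clopens_joinxC clopens_meetxC.

End ClopenAlgebra.

Section ClopenAlgebraTheory.
Variable X : topologicalType.
Implicit Types U V : clopens X.

Lemma clopens_clopen U : clopen (val U).
Proof. exact/asboolP/(valP U). Qed.

Definition to_clopens (U : set X) (cU : clopen U) : clopens X :=
  exist (@clopenb X) U (asboolT cU).

Lemma clopens_leP U V : (U <= V)%O <-> val U `<=` val V.
Proof. by rewrite -Order.le_val; split=> /subsetPset. Qed.

End ClopenAlgebraTheory.

(** * From subordination spaces to subordination algebras *)

Lemma clopen_between (T : topologicalType) (K O : set T) :
  stone_space T -> compact K -> open O -> K `<=` O ->
  exists W, [/\ clopen W, K `<=` W & W `<=` O].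
Proof.
move=> [cT hT zT] cK oO KO.
pose Q S := exists W, [/\ clopen W, S `<=` W & W `<=` O].
suff : Q K by [].
apply: compact_ind => //.
- by exists set0; split=> //; exact: clopen0.
- move=> U V [W [cW UW WO]] [W' [cW' VW' WO']]; exists (W `|` W').
  by split; [exact: clopenU|exact: setUSS|rewrite subUset].
- by move=> U V UV [W [cW VW WO]]; exists W; split=> //; exact: subset_trans VW.
- move=> x Kx.
  have xO : nbhs x O by apply: open_nbhs_nbhs; split=> //; exact: KO.
  have [W [Wx cW] WO] := zero_dimensional_cvg hT zT cT xO.
  exists W; last by exists W; split.
  by apply: open_nbhs_nbhs; split=> //; case: cW.
Qed.

Section SpaceTheory.
Variable X : S4_space.
Implicit Types (x y : X) (U V : set X).

Lemma space_compact : compact [set: X].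
Proof. by case: (Sp_stone (spaceP X)). Qed.

Lemma clopen_compact U : clopen U -> compact U.
Proof. by case=> _ cU; exact: subclosed_compact cU space_compact _. Qed.

Lemma int_S_sub U : int_S U `<=` U.
Proof. exact: (@interior_subset (tauS X)). Qed.

Lemma int_SS U V : U `<=` V -> int_S U `<=` int_S V.
Proof. by move=> UV x; apply: (@filterS (tauS X)) => //; exact: UV. Qed.

Lemma int_SI U V : int_S (U `&` V) = int_S U `&` int_S V.
Proof. exact: (@interiorI (tauS X)). Qed.

Lemma int_ST : int_S [set: X] = setT.
Proof. by apply/seteqP; split=> // x _; exact: (@filterT (tauS X)). Qed.

(** The [spec_tri]-successors of [x] are the intersection of the clopen sets [W]
    with [int_S W x], a family closed under finite intersections; compactness of
    the complement of [O] gives a single such [W] inside [O]. *)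
Lemma spec_tri_compact x (O : set X) :
  open O -> (forall y, spec_tri x y -> O y) ->
  exists W, [/\ clopen W, int_S W x & W `<=` O].
Proof.
move=> oO xO.
pose Q S := exists W, [/\ clopen W, int_S W x & W `&` S `<=` set0].
suff [W [cW Wx WO]] : Q (~` O).
  by exists W; split=> // y Wy; apply: contrapT => nOy; exact: (WO y).
apply: compact_ind.
- apply: subclosed_compact space_compact _ => //; exact: open_closedC.
- by exists setT; rewrite setI0 int_ST; split=> //; exact: clopenT.
- move=> U V [W [cW Wx WU]] [W' [cW' Wx' WV]]; exists (W `&` W').
  split; [exact: clopenI|by rewrite int_SI|].
  by move=> y [[? ?] [?|?]]; [apply: (WU y)|apply: (WV y)].
- move=> U V UV [W [cW Wx WV]]; exists W; split=> // y [? /UV ?]; exact: (WV y).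
- move=> y nOy; have : ~ spec_tri x y by move/xO.
  move=> /existsNP[W /not_implyP[cW /not_implyP[Wx Wy]]].
  exists (~` W); last by exists W; split=> //; rewrite setICr.
  by apply: open_nbhs_nbhs; split=> //; case: cW => _ /closed_openC.
Qed.

(** On clopen sets [int_S] is the box operator of [spec_tri], because the clopen
    set [W] that [spec_tri_compact] inserts below [U] has [x] in [int_S W]. *)
Lemma int_S_spec_tri x U : clopen U ->
  int_S U x <-> forall y, spec_tri x y -> U y.
Proof.
move=> cU; split=> [Ux y xy|xU]; first exact: xy.
by have [W [_ Wx WU]] := spec_tri_compact cU.1 xU; exact: int_SS WU _ Wx.
Qed.

(** For [x] in [K] the successors of [x] stay in [int_S V] because [spec_tri] is
    contained in [spec_le]; this yields an interpolant at [x], which also works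
    near [x] since [int_S] of a clopen set is open. *)
Lemma int_S_interpolate (K V : set X) : compact K -> clopen V ->
  K `<=` int_S V -> exists W, [/\ clopen W, K `<=` int_S W & W `<=` int_S V].
Proof.
move=> cK cV KV.
pose Q S := exists W, [/\ clopen W, S `<=` int_S W & W `<=` int_S V].
suff : Q K by [].
have QU U U' : Q U -> Q U' -> Q (U `|` U').
  move=> [W [cW UW WV]] [W' [cW' VW' WV']]; exists (W `|` W').
  split; [exact: clopenU| |by rewrite subUset].
  by rewrite subUset; split;
    [apply: subset_trans UW _|apply: subset_trans VW' _];
    apply: int_SS; [exact: subsetUl|exact: subsetUr].
apply: compact_ind => //.
- by exists set0; split=> //; exact: clopen0.
- move=> U U' UU' [W [cW VW WO]]; exists W.
  by split=> //; exact: subset_trans VW.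
- move=> x Kx.
  have [|W [cW Wx WV]] := @spec_tri_compact x _ (Sp_open (spaceP X) cV).
    by move=> y /(Sp_incl (spaceP X)); apply=> //; exact: KV.
  exists (int_S W); last by exists W; split.
  by apply: open_nbhs_nbhs; split=> //; exact: (Sp_open (spaceP X)).
Qed.

Definition clopen_prec (U V : clopens X) : Prop := val U `<=` int_S (val V).

Lemma clopen_precP : is_S4_subordination clopen_prec.
Proof.
split; first split.
- by move=> x.
- by rewrite /clopen_prec int_ST.
- by move=> U V W UV UW; rewrite /clopen_prec int_SI subsetI.
- by move=> U V W UW VW; rewrite /clopen_prec subUset.
- move=> U V W Z /clopens_leP UV VW /clopens_leP WZ.
  by apply: subset_trans UV (subset_trans VW _); exact: int_SS.
- by move=> U V UV; apply/clopens_leP; exact: subset_trans UV (@int_S_sub _).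
- move=> U V UV.
  have cU := clopen_compact (clopens_clopen U).
  have [W [cW UW WV]] := int_S_interpolate cU (clopens_clopen V) UV.
  by exists (to_clopens cW).
Qed.

Definition clopen_algebra : S4_algebra := S4Algebra clopen_precP.

End SpaceTheory.

(** * From subordination algebras to subordination spaces *)

(** An alias, carrying the second topology. *)
Definition stone_pointS (A : S4_algebra) : Type := stone_point A.
HB.instance Definition _ (A : S4_algebra) := Choice.on (stone_pointS A).

Section DualSpace.
Variable A : S4_algebra.
Implicit Types (a b c : A) (u v : stone_point A).

Lemma prec_sub : is_subordination (@prec A).
Proof. exact: S4_sub (precP A). Qed.

Definition stone_int a : set (stone_point A) :=
  [set u | exists2 b, prec b a & sval u b].

Lemma stone_int_cover u : exists a, stone_int a u.
Proof.
exists \top%O, \top%O; first exact: sub_top prec_sub.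
exact: filter_top (ultra_filter (svalP u)).
Qed.

Lemma stone_int_meet a b : stone_int (a `&` b)%O = stone_int a `&` stone_int b.
Proof.
apply/esym/seteqP; split=> u.
  move=> [[c ca uc] [d db ud]]; exists (c `&` d)%O.
    by apply: (sub_meet prec_sub); [apply: (sub_mono prec_sub _ ca)|
      apply: (sub_mono prec_sub _ db)]; rewrite ?lexx ?leIl ?leIr.
  by apply/ultra_meetE => //; exact: svalP.
by move=> [c cab uc]; split; exists c => //;
  apply: (sub_mono prec_sub _ cab); rewrite ?lexx ?leIl ?leIr.
Qed.

Lemma stone_int_baseI a b : exists c, stone_int a `&` stone_int b = stone_int c.
Proof. by exists (a `&` b)%O; rewrite stone_int_meet. Qed.

HB.instance Definition _ := isOpenTopological.Build (stone_pointS A)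
  (@generated_openT (stone_pointS A) _ _ stone_int_cover)
  (@generated_openI (stone_pointS A) _ _ stone_int_baseI)
  (@generated_open_bigU (stone_pointS A) _ stone_int).

Definition stone_bitop : bitopological :=
  @BiTopological (stone_point A) (Topological.class (stone_pointS A)).

Lemma stone_int_sub a : stone_int a `<=` stone_set a.
Proof.
move=> u [b /(S4_le (precP A)) ba].
exact: filter_le (ultra_filter (svalP u)) _ _ ba.
Qed.

Lemma open_stone_int a : @open (tauS stone_bitop) (stone_int a).
Proof. by move=> u au; exists a. Qed.

(** If [stone_int b] is contained in [stone_set a] and [prec c b], interpolating
    [prec c e] and [prec e b] puts [stone_set e] inside [stone_int b], hence
    inside [stone_set a]; so [e] is below [a] and [prec c a]. *)
Lemma int_S_stone_set a :
  @int_S stone_bitop (stone_set a : set stone_bitop) = stone_int a.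
Proof.
apply/seteqP; split=> u; rewrite /int_S /interior nbhsE.
  move=> [O [oO Ou] Oa]; have [b [c cb uc] bO] := oO u Ou.
  have [e [ce eb]] := S4_interp (precP A) cb.
  exists c => //; apply: (sub_mono prec_sub (lexx c) ce).
  by apply/stone_set_le => v ev; apply: Oa; apply: bO; exists e.
move=> au; exists (stone_int a); last exact: stone_int_sub.
by split=> //; exact: open_stone_int.
Qed.

Lemma spec_tri_stone (u v : stone_bitop) :
  spec_tri u v <-> forall a, stone_int a u -> sval v a.
Proof.
split=> [uv a au|uv U /clopen_is_stone_set[a <-]].
  by apply: (uv (stone_set a)); [exact: clopen_stone_set|
    rewrite int_S_stone_set].
by rewrite int_S_stone_set; exact: uv.
Qed.

Lemma stone_bitopP : is_S4_space stone_bitop.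
Proof.
split.
- exact: stone_space_stone.
- split=> [_ [U cU <-]|u N]; first exact: open_interior.
  rewrite nbhsE => -[O [oO Ou] ON]; have [a au aO] := oO u Ou.
  exists (stone_int a); last exact: subset_trans ON.
  split=> //; exists (stone_set a); last exact: int_S_stone_set.
  exact: clopen_stone_set.
- move=> U /clopen_is_stone_set[a <-]; rewrite int_S_stone_set.
  move=> u [b ba ub]; exists b => // v vb; by exists b.
- move=> u v /spec_tri_stone uv U /clopen_is_stone_set[a <-].
  rewrite int_S_stone_set => -[b ba ub].
  have [c [bc ca]] := S4_interp (precP A) ba.
  by exists c => //; apply: uv; exists b.
Qed.

Definition stone_S4_space : S4_space := S4Space stone_bitopP.

(** When [stone_set a] is contained in [stone_int b], it is covered by the
    [stone_set c] with [prec c b]; finitely many of these suffice, and their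
    join is still subordinate to [b]. *)
Lemma stone_set_prec a b : prec a b <-> stone_set a `<=` stone_int b.
Proof.
split=> [ab u ua|ab]; first by exists a.
pose Q S := exists2 c, S `<=` stone_set c & prec c b.
suff [c /stone_set_le ac cb] : Q (stone_set a).
  exact: (sub_mono prec_sub ac cb (lexx b)).
apply: compact_ind.
- by apply: (@clopen_compact stone_S4_space); exact: clopen_stone_set.
- exists \bot%O => //; apply: (sub_mono prec_sub (lexx _) (sub_bot prec_sub)).
  exact: le0x.
- move=> U V [c Uc cb] [c' Vc cb']; exists (c `|` c')%O.
    by rewrite stone_set_join; exact: setUSS.
  exact: (sub_join prec_sub).
- by move=> U V UV [c Vc cb]; exists c => //; exact: subset_trans Vc.
- move=> u /ab[c cb uc]; exists (stone_set c); last by exists c.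
  by apply/nbhs_stoneP; exists c.
Qed.

End DualSpace.

(** * The action on morphisms *)

Section DualMap.
Context {d1 d2 : Order.disp_t}.
Context {A : ctbDistrLatticeType d1} {B : ctbDistrLatticeType d2}.
Variable h : A -> B.
Hypothesis hB : is_boolean_hom h.

Lemma boolean_hom_le a b : (a <= b)%O -> (h a <= h b)%O.
Proof. by move=> /meet_idPl ab; apply/meet_idPl; rewrite -(hom_meet hB) ab. Qed.

Lemma preimage_ultrafilter (v : set B) :
  is_ultrafilter v -> is_ultrafilter (h @^-1` v).
Proof.
move=> uv; have fv := ultra_filter uv; split; first split.
- by rewrite /preimage /= (hom_top hB); exact: filter_top.
- by move=> a b va vb; rewrite /preimage /= (hom_meet hB); exact: filter_meet.
- by move=> a b ab; exact: filter_le fv _ _ (boolean_hom_le ab).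
- by move=> a; rewrite /preimage /= (hom_compl hB); exact: ultra_compl.
Qed.

Definition stone_map (v : stone_point B) : stone_point A :=
  exist _ _ (preimage_ultrafilter (svalP v)).

Lemma stone_map_continuous : continuous stone_map.
Proof.
move=> v N /nbhs_stoneP[a va aN]; apply/nbhs_stoneP; exists (h a) => // w wa.
exact: aN.
Qed.

End DualMap.

Section DualMapS4.
Variables (A B : S4_algebra) (h : A -> B).

Lemma stone_map_stable (hh : is_sub_hom h) :
  @is_stable (stone_S4_space B) (stone_S4_space A)
    (stone_map (sub_hom_bool hh)).
Proof.
split; first exact: stone_map_continuous.
move=> v w /spec_tri_stone vw; apply/spec_tri_stone => a [b ba vb].
by apply: vw; exists (h b) => //; exact: sub_hom_prec.
Qed.

(** Were the filter [F] improper, some [b] with an element of [v] subordinate to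
    it would be disjoint from [h c] with [c] in [y], that is, [b] would be below
    [h] of the complement of [c].  The condition on [h] moves this subordination back to [A], which puts
    the complement of [c] in [y]. *)
Lemma stone_map_strong_stable (hh : is_strong_sub_hom h) :
  @is_strong_stable (stone_S4_space B) (stone_S4_space A)
    (stone_map (sub_hom_bool (strong_sub_hom hh))).
Proof.
have hB := sub_hom_bool (strong_sub_hom hh).
split; first exact: stone_map_stable.
move=> v y /spec_tri_stone vy; have pS := prec_sub B.
pose F : set B :=
  [set e | exists2 b, stone_int b v & exists2 c, sval y c & (b `&` h c <= e)%O].
have fF : is_filter F.
  split.
  - have [b vb] := stone_int_cover v; exists b => //; exists \top%O.
      exact: filter_top (ultra_filter (svalP y)).
    exact: lex1.
  - move=> e e' [b vb [c yc ce]] [b' vb' [c' yc' ce']].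
    exists (b `&` b')%O; first by rewrite stone_int_meet.
    exists (c `&` c')%O.
      exact: filter_meet (ultra_filter (svalP y)) _ _ _ _.
    rewrite (hom_meet hB) lexI (le_trans _ ce) ?(le_trans _ ce')//;
    by rewrite leI2 ?leIl ?leIr.
  - move=> e e' ee' [b vb [c yc ce]]; exists b => //; exists c => //.
    exact: le_trans ce ee'.
have F0 : ~ F \bot%O.
  move=> [b [b' b'b vb'] [c yc]]; rewrite lex0 disj_leC -(hom_compl hB) => bc.
  have [e [b'e ec]] : exists e, (b' <= h e)%O /\ prec e (~` c)%O.
    by apply: (strong_sub_homQ hh); exact: (sub_mono pS (lexx b') b'b bc).
  have : sval y (~` c)%O.
    apply: vy; exists e => //.
    exact: filter_le (ultra_filter (svalP v)) _ _ b'e vb'.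
  by move/(ultra_compl (svalP y)).
have [z uz Fz] := filter_extension fF F0.
exists (exist _ z uz); split.
  apply/spec_tri_stone => b vb; apply: Fz; exists b => //; exists \top%O.
    exact: filter_top (ultra_filter (svalP y)).
  exact: leIl.
apply/esym/stone_point_eq => c yc; apply: Fz.
have [b vb] := stone_int_cover v; exists b => //; exists c => //; exact: leIr.
Qed.

End DualMapS4.

Section ClopenMap.
Variables (X Y : S4_space) (f : X -> Y).

Lemma clopen_preimage (cf : continuous f) (V : set Y) :
  clopen V -> clopen (f @^-1` V).
Proof. by move=> cV; apply: preimage_clopen. Qed.

Definition clopen_map (cf : continuous f) (V : clopens Y) : clopens X :=
  to_clopens (clopen_preimage cf (clopens_clopen V)).

Lemma clopen_map_boolean (cf : continuous f) : is_boolean_hom (clopen_map cf).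
Proof. by split; [move=> U V|move=> U V|move=> U| |]; apply: val_inj. Qed.

Lemma clopen_map_sub_hom (sf : is_stable f) :
  @is_sub_hom (clopen_algebra Y) (clopen_algebra X)
    (clopen_map (stable_continuous sf)).
Proof.
split; first exact: clopen_map_boolean.
move=> U V UV x Ux.
apply/int_S_spec_tri; first exact: clopens_clopen.
move=> y /(stable_tri sf) fxy; apply: fxy; first exact: clopens_clopen.
exact: UV.
Qed.

(** The image of [U] is compact and lies in the open set [int_S V]; a clopen set
    between them is the witness sought. *)
Lemma clopen_map_strong_sub_hom (sf : is_strong_stable f) :
  @is_strong_sub_hom (clopen_algebra Y) (clopen_algebra X)
    (clopen_map (stable_continuous (strong_stable sf))).
Proof.
have cf := stable_continuous (strong_stable sf).
split; first exact: clopen_map_sub_hom.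
move=> U V UV.
have fUV : f @` val U `<=` int_S (val V).
  move=> _ [x Ux <-]; apply/int_S_spec_tri; first exact: clopens_clopen.
  move=> y /(strong_stable_back sf)[z [xz <-]].
  apply: (xz (f @^-1` val V)); last exact: UV.
  exact/(clopen_preimage cf)/clopens_clopen.
have [| |W [cW UW WV]] := clopen_between (Sp_stone (spaceP Y)) _ _ fUV.
- apply: continuous_compact; last exact/clopen_compact/clopens_clopen.
  exact: continuous_subspaceT.
- exact/(Sp_open (spaceP Y))/clopens_clopen.
exists (to_clopens cW); split=> //.
by apply/clopens_leP => x Ux; apply: UW; exists x.
Qed.

End ClopenMap.

(** * The unit isomorphisms *)

Section AlgebraUnit.
Variable A : S4_algebra.
Local Notation dual := (clopen_algebra (stone_S4_space A)).

Definition alg_unit (a : A) : dual := to_clopens (clopen_stone_set a).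

Definition alg_unit_inv (C : dual) : A :=
  sval (cid (clopen_is_stone_set (clopens_clopen C))).

Lemma alg_unit_invK : cancel alg_unit_inv alg_unit.
Proof.
move=> C; apply: val_inj.
exact: (svalP (cid (clopen_is_stone_set (clopens_clopen C)))).
Qed.

Lemma alg_unitK : cancel alg_unit alg_unit_inv.
Proof.
move=> a; apply: stone_set_inj.
exact: (congr1 val (alg_unit_invK (alg_unit a))).
Qed.

Lemma alg_unit_hom : is_sub_hom alg_unit.
Proof.
split; first split.
- by move=> a b; apply: val_inj; exact: stone_set_meet.
- by move=> a b; apply: val_inj; exact: stone_set_join.
- by move=> a; apply: val_inj; exact: stone_set_compl.
- by apply: val_inj; exact: stone_set_bot.
- by apply: val_inj; exact: stone_set_top.
move=> a b /stone_set_prec ab; rewrite /prec /= /clopen_prec /=.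
by rewrite int_S_stone_set.
Qed.

Lemma alg_unit_inv_hom : is_sub_hom alg_unit_inv.
Proof.
have [[hI hU hC h0 h1] _] := alg_unit_hom.
split; first split.
- by move=> C D; apply: (can_inj alg_unitK); rewrite hI !alg_unit_invK.
- by move=> C D; apply: (can_inj alg_unitK); rewrite hU !alg_unit_invK.
- by move=> C; apply: (can_inj alg_unitK); rewrite hC !alg_unit_invK.
- by apply: (can_inj alg_unitK); rewrite h0 alg_unit_invK.
- by apply: (can_inj alg_unitK); rewrite h1 alg_unit_invK.
move=> C D; rewrite -[C in prec C]alg_unit_invK -[D in prec _ D]alg_unit_invK.
by rewrite /prec /= /clopen_prec /= int_S_stone_set => /stone_set_prec.
Qed.

End AlgebraUnit.

Section SpaceUnit.
Variable X : S4_space.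
Local Notation bidual := (stone_S4_space (clopen_algebra X)).

Definition clopen_trace (x : X) : set (clopens X) := [set U | val U x].

Lemma clopen_trace_ultra x : is_ultrafilter (clopen_trace x).
Proof.
split; first split.
- by [].
- by move=> U V.
- by move=> U V /clopens_leP UV; exact: UV.
- by move=> U.
Qed.

Definition space_unit (x : X) : bidual := exist _ _ (clopen_trace_ultra x).

(** If every point had a clopen neighbourhood outside [u], compactness would
    produce a member of [u] that is empty.  So the members of [u] contain all
    clopen neighbourhoods of some [x], and maximality gives equality. *)
Lemma space_unit_surj (u : bidual) : exists x, space_unit x = u.
Proof.
have uu : is_ultrafilter (sval u) := svalP u; have fu := ultra_filter uu.
have [x xu] : exists x : X, forall U : clopens X, val U x -> sval u U.
  apply: contrapT => /forallNP nx.
  pose Q (S : set X) := exists2 U : clopens X, sval u U & val U `&` S `<=` set0.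
  have [U uU U0] : Q setT.
    apply: compact_ind; first exact: space_compact.
    - by exists \top%O; [exact: filter_top|rewrite setI0].
    - move=> S S' [U uU US] [V uV VS']; exists (U `&` V)%O.
        exact: filter_meet.
      by move=> x [[Ux Vx] [?|?]]; [exact: (US x)|exact: (VS' x)].
    - move=> S S' SS' [U uU US']; exists U => // x [Ux /SS' ?].
      exact: (US' x).
    - move=> x _; have /existsNP[U /not_implyP[Ux nuU]] := nx x.
      exists (val U).
        by apply: open_nbhs_nbhs; split=> //; case: (clopens_clopen U).
      exists (~` U)%O; first exact/(ultra_compl uu).
      by move=> y [].
  apply: (ultra_bot uu); apply: filter_le uU => //.
  by apply/clopens_leP => x Ux; apply: (U0 x).
by exists x; exact: stone_point_eq.
Qed.

Lemma space_unit_inj : injective space_unit.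
Proof.
move=> x y xy; have [_ _ zX] := Sp_stone (spaceP X).
apply: contrapT => /eqP/zX[U [cU Ux Uy]]; apply: Uy.
have : sval (space_unit x) (to_clopens cU) by [].
by rewrite xy.
Qed.

Definition space_unit_inv (u : bidual) : X := sval (cid (space_unit_surj u)).

Lemma space_unit_invK : cancel space_unit_inv space_unit.
Proof. by move=> u; exact: (svalP (cid (space_unit_surj u))). Qed.

Lemma space_unitK : cancel space_unit space_unit_inv.
Proof. by move=> x; apply: space_unit_inj; rewrite space_unit_invK. Qed.

Lemma space_unit_tri x y :
  spec_tri (space_unit x) (space_unit y) <-> spec_tri x y.
Proof.
split=> [/spec_tri_stone xy U cU Ux|xy].
  apply: (xy (to_clopens cU)).
  have [|V [cV xV VU]] := clopen_between (Sp_stone (spaceP X))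
    (@compact_set1 X x) (Sp_open (spaceP X) cU); first by move=> _ ->.
  by exists (to_clopens cV) => //; exact: xV.
apply/spec_tri_stone => U [V VU Vx]; apply: xy; first exact: clopens_clopen.
exact: VU.
Qed.

Lemma space_unit_stable : is_stable space_unit.
Proof.
split; last by move=> x y /space_unit_tri.
move=> x N /nbhs_stoneP[U xU UN].
apply: (@filterS X _ _ (val U)); first by move=> y Uy; exact: UN.
by apply: open_nbhs_nbhs; split=> //; case: (clopens_clopen U).
Qed.

Lemma space_unit_inv_stable : is_stable space_unit_inv.
Proof.
split=> [u N uN|u v uv]; last first.
  by apply/space_unit_tri; rewrite !space_unit_invK.
have [cX hX zX] := Sp_stone (spaceP X).
have [W [Wu cW] WN] := zero_dimensional_cvg hX zX cX uN.
have WE v : stone_set (to_clopens cW) v <-> W (space_unit_inv v).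
  by rewrite -{1}(space_unit_invK v).
by apply/nbhs_stoneP; exists (to_clopens cW) => [|v /WE/WN //]; apply/WE.
Qed.

End SpaceUnit.

(** * The dual equivalences *)

(** Both pairs of categories have the same objects and differ only in the
    classes of maps that are admitted.  What the duality needs from such classes
    is that the two functors exchange them and that they contain all
    isomorphisms. *)
Section Duality.
Variable alg_mor : forall A B : S4_algebra, (A -> B) -> Prop.
Variable space_mor : forall X Y : S4_space, (X -> Y) -> Prop.
Hypothesis alg_mor_id : forall A : S4_algebra,
  alg_mor (A := A) (B := A) (fun x => x).
Hypothesis alg_mor_comp : forall (A B C : S4_algebra) (g : B -> C) (f : A -> B),
  alg_mor g -> alg_mor f -> alg_mor (fun x => g (f x)).
Hypothesis space_mor_id : forall X : S4_space,
  space_mor (X := X) (Y := X) (fun x => x).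
Hypothesis space_mor_comp : forall (X Y Z : S4_space) (g : Y -> Z) (f : X -> Y),
  space_mor g -> space_mor f -> space_mor (fun x => g (f x)).
Hypothesis alg_mor_hom : forall (A B : S4_algebra) (h : A -> B),
  alg_mor h -> is_sub_hom h.
Hypothesis space_mor_stable : forall (X Y : S4_space) (f : X -> Y),
  space_mor f -> is_stable f.
Hypothesis space_mor_stone_map :
  forall (A B : S4_algebra) (h : A -> B) (hh : alg_mor h),
  @space_mor (stone_S4_space B) (stone_S4_space A)
    (stone_map (sub_hom_bool (alg_mor_hom hh))).
Hypothesis alg_mor_clopen_map :
  forall (X Y : S4_space) (f : X -> Y) (hf : space_mor f),
  @alg_mor (clopen_algebra Y) (clopen_algebra X)
    (clopen_map (stable_continuous (space_mor_stable hf))).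
Hypothesis alg_mor_iso : forall (A B : S4_algebra) (h : A -> B) (g : B -> A),
  is_sub_hom h -> is_sub_hom g -> cancel h g -> cancel g h -> alg_mor h.
Hypothesis space_mor_iso : forall (X Y : S4_space) (f : X -> Y) (g : Y -> X),
  is_stable f -> is_stable g -> cancel f g -> cancel g f -> space_mor f.

Let algC : category := concrete_category alg_mor_id alg_mor_comp.
Let spaceC : category := concrete_category space_mor_id space_mor_comp.

Definition stone_functor : functor (op_category algC) spaceC.
Proof.
refine (@Functor (op_category algC) spaceC stone_S4_space
  (fun A B h => exist _ _ (space_mor_stone_map (svalP h))) _ _).
- move=> A; apply: eq_exist; apply/funext => u; exact: stone_point_eq.
- move=> A B C g f; apply: eq_exist; apply/funext => u; exact: stone_point_eq.
Defined.

Definition clopen_functor : functor spaceC (op_category algC).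
Proof.
refine (@Functor spaceC (op_category algC) clopen_algebra
  (fun X Y f => exist _ _ (alg_mor_clopen_map (svalP f))) _ _).
- move=> X; apply: eq_exist; apply/funext => U; exact: val_inj.
- move=> X Y Z g f; apply: eq_exist; apply/funext => U; exact: val_inj.
Defined.

Lemma wide_duality : dually_equivalent algC spaceC.
Proof.
exists stone_functor, clopen_functor; split.
  exists (fun A : op_category algC => exist _ _
    (alg_mor_iso (alg_unit_inv_hom A) (alg_unit_hom A)
       (@alg_unit_invK A) (@alg_unitK A))); split.
    move=> A; exists (exist _ _
      (alg_mor_iso (alg_unit_hom A) (alg_unit_inv_hom A)
       (@alg_unitK A) (@alg_unit_invK A))); split.
    + by apply: eq_exist; apply/funext => a; exact: alg_unitK.
    + by apply: eq_exist; apply/funext => C; exact: alg_unit_invK.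
  move=> A B h; apply: eq_exist; apply/funext => C /=.
  (* Naturality of the inverse unit follows from that of the unit. *)
  apply: (can_inj (@alg_unitK A)); rewrite alg_unit_invK.
  apply: val_inj => /=; rewrite -[in RHS](alg_unit_invK C).
  by apply/funext.
exists (fun X : spaceC => exist _ _
    (space_mor_iso (space_unit_inv_stable X) (space_unit_stable X)
       (@space_unit_invK X) (@space_unitK X))); split.
  move=> X; exists (exist _ _
      (space_mor_iso (space_unit_stable X) (space_unit_inv_stable X)
       (@space_unitK X) (@space_unit_invK X))); split.
  + by apply: eq_exist; apply/funext => u; exact: space_unit_invK.
  + by apply: eq_exist; apply/funext => x; exact: space_unitK.
move=> X Y f; apply: eq_exist; apply/funext => u /=.
apply: space_unit_inj; rewrite space_unit_invK.
by rewrite -[in LHS](space_unit_invK u); exact: stone_point_eq.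
Qed.

End Duality.

(** The inverse homomorphism supplies the witness [c := g a]. *)
Lemma sub_hom_iso_strong (A B : S4_algebra) (h : A -> B) (g : B -> A) :
  is_sub_hom h -> is_sub_hom g -> cancel h g -> cancel g h ->
  is_strong_sub_hom h.
Proof.
move=> hh hg hK gK; split=> // a b /(sub_hom_prec hg); rewrite hK => ab.
by exists (g a); rewrite gK.
Qed.

(** The inverse map supplies the witness [z := g y]. *)
Lemma stable_iso_strong (X Y : S4_space) (f : X -> Y) (g : Y -> X) :
  is_stable f -> is_stable g -> cancel f g -> cancel g f ->
  is_strong_stable f.
Proof.
move=> hf hg fK gK; split=> // x y /(stable_tri hg); rewrite fK => xy.
by exists (g y).
Qed.

Theorem theorem31 :
  dually_equivalent SubS4_h BiSpS4_s /\ dually_equivalent SubS4_st BiSpS4_st.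
Proof.
split.
  apply: (@wide_duality _ _ _ _ _ _ (fun A B h => id) (fun X Y f => id)).
  - exact: stone_map_stable.
  - exact: clopen_map_sub_hom.
  - by [].
  - by [].
apply: (@wide_duality _ _ _ _ _ _ strong_sub_hom strong_stable).
- exact: stone_map_strong_stable.
- exact: clopen_map_strong_sub_hom.
- exact: sub_hom_iso_strong.
- exact: stable_iso_strong.
Qed.
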